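(* (Ashikhmin-Barg condition for sum-rank metric codes.) Let $\mathcal{C}$ be a (nondegenerate, nonzero) $[\mathbf{n},k]_{q^m/q}$ sum-rank metric code with $\mathbf{n}=(n_1,\ldots,n_t)$. Put \[ \delta_{\max}=\max_{(r_1,\ldots,r_t)\in S(\mathcal{C})}\ \sum_{i=1}^t\frac{q^{n_i}-q^{n_i-r_i}}{q-1},\qquad \delta_{\min}=\min_{(r_1,\ldots,r_t)\in S(\mathcal{C})}\ \sum_{i=1}^t\frac{q^{n_i}-q^{n_i-r_i}}{q-1}, \] where $S(\mathcal{C})$ is the set of rank-lists of the nonzero codewords of $\mathcal{C}$. If \[ \frac{\delta_{\max}}{\delta_{\min}}<\frac{q^m}{q^m-1}, \] then $\mathcal{C}$ is minimal.
   Context: Let $q$ be a prime power, $m,t,k$ positive integers, $\mathbf{n}=(n_1,\ldots,n_t)$ a tuple of positive integers and $\mathbb{F}_{q^m}^{\mathbf{n}}=\bigoplus_{i=1}^t\mathbb{F}_{q^m}^{n_i}$. The rank of $v=(v_1,\ldots,v_n)\in\mathbb{F}_{q^m}^n$ is $\mathrm{rk}(v)=\dim_{\mathbb{F}_q}\langle v_1,\ldots,v_n\rangle_{\mathbb{F}_q}$; the rank-list of $x=(x_1,\ldots,x_t)\in\mathbb{F}_{q^m}^{\mathbf{n}}$ is $(\mathrm{rk}(x_1),\ldots,\mathrm{rk}(x_t))$ and its sum-rank weight is the sum of the entries of the rank-list; the distance is the weight of the difference. An $[\mathbf{n},k]_{q^m/q}$ code is a $k$-dimensional $\mathbb{F}_{q^m}$-subspace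 of $\mathbb{F}_{q^m}^{\mathbf{n}}$. A generator matrix is $G=(G_1|\cdots|G_t)$, $G_i\in\mathbb{F}_{q^m}^{k\times n_i}$, whose rows form a basis of $\mathcal{C}$. $\mathcal{C}$ is nondegenerate if for each $i$ the columns of $G_i$ are $\mathbb{F}_q$-linearly independent. All codes are assumed nondegenerate. Support: fix an $\mathbb{F}_q$-basis of $\mathbb{F}_{q^m}$; for $x_i\in\mathbb{F}_{q^m}^{n_i}$ let $\Gamma(x_i)\in\mathbb{F}_q^{n_i\times m}$ be the matrix whose $j$-th row consists of the coordinates of the $j$-th entry of $x_i$. The sum-rank support of $x$ is the tuple $(\mathrm{colsp}\,\Gamma(x_1),\ldots,\mathrm{colsp}\,\Gamma(x_t))$ of $\mathbb{F}_q$-column spaces (independent of the basis); inclusion of supports is componentwise. A codeword $c\in\mathcal{C}$ is minimal if every $c'\in\mathcal{C}$ whose support is contained in the support of $c$ satisfies $c'=\lambda c$ for some $\lambda\in\mathbb{F}_{q^m}$. $\mathcal{C}$ is minimal if all its codewords are minimal. *)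

(* Defs.v *)
From HB Require Import structures.
From mathcomp Require Import all_boot all_order all_algebra all_field.
Set Implicit Arguments.
Unset Strict Implicit.
Unset Printing Implicit Defensive.
Import Order.TTheory GRing.Theory Num.Theory.
Local Open Scope ring_scope.

(* F is F_q and L is F_{q^m}.  The ambient space F_{q^m}^n, the direct sum of  *)
(* the F_{q^m}^{n_i}, is the space of row vectors of length \sum_i n i, whose  *)
(* i-th component x_i is submxrow x i.                                         *)

Definition rk (F : finFieldType) (L : fieldExtType F) (n : nat)
    (v : 'rV[L]_n) : nat :=
  \dim <<[tuple v ord0 j | j < n]>>%VS.

Definition rank_list (F : finFieldType) (L : fieldExtType F) (t : nat)
    (n : 'I_t -> nat) (x : 'rV[L]_(\sum_i n i)) : {ffun 'I_t -> nat} :=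
  [ffun i => rk (submxrow x i)].

(* S(C), as a predicate on lists r = (r_1, ..., r_t). *)
Definition code_rank_list (F : finFieldType) (L : fieldExtType F) (t : nat)
    (n : 'I_t -> nat) (C : {vspace 'rV[L]_(\sum_i n i)})
    (r : {ffun 'I_t -> nat}) : Prop :=
  exists c : 'rV[L]_(\sum_i n i), [/\ c \in C, c != 0 & rank_list c = r].

Definition generator_matrix (F : finFieldType) (L : fieldExtType F) (k N : nat)
    (C : {vspace 'rV[L]_N}) (G : 'M[L]_(k, N)) : Prop :=
  basis_of C [tuple row i G | i < k].

(* M *m map_mx (in_alg L) a is the combination of the columns of M with        *)
(* coefficients a_j in F.                                                      *)
Definition col_free_over (F : finFieldType) (L : fieldExtType F) (k n : nat)
    (M : 'M[L]_(k, n)) : Prop :=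
  forall a : 'cV[F]_n, M *m map_mx (in_alg L) a = 0 -> a = 0.

Definition nondegenerate_code (F : finFieldType) (L : fieldExtType F) (t : nat)
    (n : 'I_t -> nat) (C : {vspace 'rV[L]_(\sum_i n i)}) : Prop :=
  exists2 G : 'M[L]_(\dim C, \sum_i n i), generator_matrix C G &
    forall i, col_free_over (submxrow G i).

(* Coordinates are taken in the F-basis e of L. *)
Definition Gamma (F : finFieldType) (L : fieldExtType F) (m : nat)
    (e : m.-tuple L) (n : nat) (v : 'rV[L]_n) : 'M[F]_(n, m) :=
  \matrix_(j, l) coord e l (v 0 j).

Definition colsp (F : fieldType) (n m : nat) (A : 'M[F]_(n, m)) :
    {vspace 'cV[F]_n} :=
  <<[tuple col l A | l < m]>>%VS.

Definition sr_support (F : finFieldType) (L : fieldExtType F) (m : nat)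
    (e : m.-tuple L) (t : nat) (n : 'I_t -> nat) (x : 'rV[L]_(\sum_i n i))
    (i : 'I_t) : {vspace 'cV[F]_(n i)} :=
  colsp (Gamma e (submxrow x i)).

Definition minimal_codeword (F : finFieldType) (L : fieldExtType F) (m : nat)
    (e : m.-tuple L) (t : nat) (n : 'I_t -> nat)
    (C : {vspace 'rV[L]_(\sum_i n i)}) (c : 'rV[L]_(\sum_i n i)) : Prop :=
  forall c' : 'rV[L]_(\sum_i n i), c' \in C ->
    (forall i, sr_support e c' i <= sr_support e c i)%VS ->
    exists lambda : L, c' = lambda *: c.

Definition minimal_code (F : finFieldType) (L : fieldExtType F) (m : nat)
    (e : m.-tuple L) (t : nat) (n : 'I_t -> nat)
    (C : {vspace 'rV[L]_(\sum_i n i)}) : Prop :=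
  forall c : 'rV[L]_(\sum_i n i), c \in C -> minimal_codeword e C c.

(* The exponent n i - r i is a truncated subtraction; rank lists of vectors    *)
(* satisfy r i <= n i.                                                         *)
Definition delta_value (q t : nat) (n : 'I_t -> nat) (r : {ffun 'I_t -> nat}) : rat :=
  \sum_(i < t) (q%:R ^+ n i - q%:R ^+ (n i - r i)%N) / (q%:R - 1).

Definition is_max (T : Type) (S : T -> Prop) (f : T -> rat) (d : rat) : Prop :=
  (exists2 x, S x & f x = d) /\ (forall x, S x -> f x <= d).

Definition is_min (T : Type) (S : T -> Prop) (f : T -> rat) (d : rat) : Prop :=
  (exists2 x, S x & f x = d) /\ (forall x, S x -> d <= f x).

(* Main.v *)
Require Import Defs.
From HB Require Import structures.
From mathcomp Require Import all_boot all_order all_algebra all_field.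
Set Implicit Arguments.
Unset Strict Implicit.
Unset Printing Implicit Defensive.
Import Order.TTheory GRing.Theory Num.Theory.
Local Open Scope ring_scope.

(* Extend x = (x_1, ..., x_t) to the vector whose coordinates are all the      *)
(* F_q-combinations of the entries of each x_i.  A component x_i of rank r_i   *)
(* gives q^(n_i) - q^(n_i - r_i) nonzero coordinates, so the delta value of    *)
(* the rank list of x is the Hamming weight of the extension over q - 1, and   *)
(* inclusion of sum-rank supports gives inclusion of Hamming supports.  The    *)
(* classical Ashikhmin-Barg argument then applies: if supp c' is included in   *)
(* supp c, each coordinate in supp c' vanishes in c - l c' for exactly one     *)
(* l <> 0, and the other coordinates of supp c for none, hence                 *)
(* \sum_(l != 0) wt (c - l c') = (q^m - 1) wt c - wt c'.  If c' is not a       *)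
(* multiple of c then c' and all the c - l c' are nonzero, so                  *)
(* q^m wt_min <= (q^m - 1) wt_max.                                             *)

(** Three facts carry the count. [ext_weightE] is rank-nullity and turns delta values into weights;
    [pairing_eq0_colsp] turns inclusion of supports into inclusion of zero sets; [sum_sr_ext_weight]
    is the sum over nonzero scalars, assembled from the one-coordinate identity [sum_neq0_subZ]. *)

Section ExtendedWeight.
Variables (F : finFieldType) (L : fieldExtType F).
Implicit Types (z : L).

Definition pairing (n : nat) (v : 'rV[L]_n) (a : 'cV[F]_n) : L :=
  \sum_j a j 0 *: v 0 j.

Definition ext_weight (n : nat) (v : 'rV[L]_n) : nat :=
  (\sum_(a : 'cV[F]_n) (pairing v a != 0%R))%N.

Lemma pairing_is_linear (n : nat) (v : 'rV[L]_n) : linear (pairing v).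
Proof.
move=> k a b; rewrite /pairing scaler_sumr -big_split; apply: eq_bigr => j _.
by rewrite !mxE scalerDl scalerA.
Qed.

HB.instance Definition _ (n : nat) (v : 'rV[L]_n) :=
  GRing.isLinear.Build F 'cV[F]_n L *:%R (pairing v) (pairing_is_linear v).

Lemma pairingBZ (n : nat) (v w : 'rV[L]_n) z (a : 'cV[F]_n) :
  pairing (v - z *: w) a = pairing v a - z * pairing w a.
Proof.
rewrite /pairing mulr_sumr -sumrB; apply: eq_bigr => j _.
by rewrite !mxE scalerBr scalerAr.
Qed.

Lemma pairing_delta (n : nat) (v : 'rV[L]_n) j :
  pairing v (delta_mx j 0) = v 0 j.
Proof.
rewrite /pairing (bigD1 j) //= big1 => [|i /negPf ij].
  by rewrite mxE !eqxx scale1r addr0.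
by rewrite mxE ij scale0r.
Qed.

Lemma limg_pairing (n : nat) (v : 'rV[L]_n) :
  limg (linfun (pairing v)) = <<[tuple v ord0 j | j < n]>>%VS.
Proof.
apply/eqP; rewrite eqEsubv; apply/andP; split.
  apply/subvP=> _ /memv_imgP[a _ ->]; rewrite lfunE memv_suml // => j _.
  by rewrite memvZ // memv_span //; apply/mapP; exists j; rewrite ?mem_enum.
apply/span_subvP=> _ /mapP[j _ ->]; rewrite -pairing_delta.
by rewrite -[pairing v _](lfunE (pairing v)) memv_img ?memvf.
Qed.

Lemma dim_ker_pairing (n : nat) (v : 'rV[L]_n) :
  (\dim (lker (linfun (pairing v))) + rk v = n)%N.
Proof.
rewrite /rk -limg_pairing -[X in (\dim X + _)%N]capfv limg_ker_dim.
by rewrite dimvf dim_matrix [LHS]muln1.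
Qed.

(** The zero coordinates of the extension form the kernel of [pairing v], of dimension [n - rk v]
    over [F]. *)
Lemma ext_weightE (n : nat) (v : 'rV[L]_n) :
  (ext_weight v + #|F| ^ (n - rk v) = #|F| ^ n)%N.
Proof.
have -> : (n - rk v)%N = \dim (lker (linfun (pairing v))).
  exact: canLR (addnK _) (esym (dim_ker_pairing v)).
rewrite -card_vspace /ext_weight -big_mkcond sum1_card.
have -> : (#|F| ^ n)%N = #|{: 'cV[F]_n}| by rewrite card_mx muln1.
rewrite addnC -(cardC (mem (lker (linfun (pairing v))))).
by congr (_ + _)%N; apply: eq_card => a; rewrite !inE memv_ker lfunE.
Qed.

Lemma ext_weight_gt0 (n : nat) (v : 'rV[L]_n) : v != 0 -> (0 < ext_weight v)%N.
Proof.
case/rV0Pn=> j vj; rewrite /ext_weight (bigD1 (delta_mx j 0)) //=.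
by rewrite pairing_delta vj.
Qed.

(** When [z'] is nonzero so is [z], and exactly one nonzero scalar, [z / z'], kills [z - l * z'];
    the summand [z' != 0] makes up for that lost term. *)
Lemma sum_neq0_subZ z z' : (z = 0 -> z' = 0) ->
  (\sum_(l : finvect_type L | l != 0%R) (z - (l : L) * z' != 0)%R + (z' != 0%R)
   = #|finvect_type L|.-1 * (z != 0%R))%N.
Proof.
have [-> _|nz' zz'] := eqVneq z' 0.
  under eq_bigr do rewrite mulr0 subr0.
  by rewrite sum_nat_const cardC1 addn0.
have nz : z != 0 by apply: contra_neq nz'.
rewrite nz muln1 (bigD1 (z / z' : finvect_type L)) /=; last first.
  by rewrite mulf_neq0 ?invr_eq0.
rewrite mulfVK // subrr eqxx add0n -(cardC1 (0 : finvect_type L)) -sum1_card.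
rewrite [RHS](bigD1 (z / z' : finvect_type L)) /=; last first.
  by rewrite inE mulf_neq0 ?invr_eq0.
rewrite addnC; congr (_ + _)%N; apply: eq_bigr => l /andP[_ nl].
apply/eqP; rewrite eqb1 subr_eq0; apply: contra_neq nl => ->.
by rewrite mulfK.
Qed.

Lemma sum_ext_weight (n : nat) (v w : 'rV[L]_n) :
    (forall a, pairing v a = 0 -> pairing w a = 0) ->
  (\sum_(l : finvect_type L | l != 0%R) ext_weight (v - (l : L) *: w)%R
   + ext_weight w = #|finvect_type L|.-1 * ext_weight v)%N.
Proof.
move=> vw; rewrite exchange_big -big_split big_distrr /=.
apply: eq_bigr => a _; rewrite -(sum_neq0_subZ (vw a)).
by congr (_ + _)%N; apply: eq_bigr => l _; rewrite pairingBZ.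
Qed.

Lemma coord_pairing (m n : nat) (e : m.-tuple L) (v : 'rV[L]_n) a l :
  coord e l (pairing v a) = (a^T *m col l (Gamma e v)) 0 0.
Proof.
by rewrite linear_sum mxE; apply: eq_bigr => j _; rewrite linearZ !mxE.
Qed.

(** By [coord_pairing], [pairing v a] vanishes exactly when [a^T] annihilates the column space of
    [Gamma e v], hence every subspace of it. *)
Lemma pairing_eq0_colsp (m n : nat) (e : m.-tuple L) (v w : 'rV[L]_n) a :
    basis_of {:L} e -> (colsp (Gamma e w) <= colsp (Gamma e v))%VS ->
  pairing v a = 0 -> pairing w a = 0.
Proof.
move=> he wv va0.
have sub_ker : (colsp (Gamma e v) <= lker (linfun (mulmx a^T)))%VS.
  apply/span_subvP=> _ /mapP[l _ ->]; rewrite memv_ker lfunE /=.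
  by apply/eqP/rowP=> i; rewrite !ord1 -coord_pairing va0 linear0 mxE.
rewrite (coord_basis he (memvf (pairing w a))) big1 // => l _.
rewrite coord_pairing.
have : col l (Gamma e w) \in lker (linfun (mulmx a^T)).
  apply: (subvP (subv_trans wv sub_ker)); rewrite memv_span //.
  by apply/mapP; exists l; rewrite ?mem_enum.
by rewrite memv_ker lfunE /= => /eqP ->; rewrite mxE scale0r.
Qed.

End ExtendedWeight.

Section SumRankWeight.
Variables (F : finFieldType) (L : fieldExtType F) (t : nat) (n : 'I_t -> nat).
Implicit Types x y : 'rV[L]_(\sum_i n i).

Definition sr_ext_weight x : nat := (\sum_i ext_weight (submxrow x i))%N.

Lemma delta_value_rank_list x :
  delta_value #|F| n (rank_list x) = (sr_ext_weight x)%:R / (#|F|%:R - 1).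
Proof.
rewrite /delta_value /sr_ext_weight natr_sum mulr_suml; apply: eq_bigr => i _.
by rewrite ffunE -!natrX -[in LHS](ext_weightE (submxrow x i)) natrD addrK.
Qed.

Lemma sr_ext_weight0 : sr_ext_weight 0 = 0%N.
Proof.
rewrite /sr_ext_weight big1 // => i _; apply: big1 => a _.
by rewrite submxrow0 /pairing big1 ?eqxx // => j _; rewrite mxE scaler0.
Qed.

Lemma sr_ext_weight_gt0 x : x != 0 -> (0 < sr_ext_weight x)%N.
Proof.
move=> nx; have [i nxi] : exists i, submxrow x i != 0.
  apply/existsP; apply: contra_neqT nx => /existsPn x0.
  rewrite -[x]submxrowK -[RHS]submxrowK; apply: eq_mxrow => i.
  by rewrite submxrow0; apply/eqP/negPn/x0.
by rewrite /sr_ext_weight (bigD1 i) //= addn_gt0 ext_weight_gt0.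
Qed.

Lemma sum_sr_ext_weight (m : nat) (e : m.-tuple L) x y :
    basis_of {:L} e -> (forall i, sr_support e y i <= sr_support e x i)%VS ->
  (\sum_(l : finvect_type L | l != 0%R) sr_ext_weight (x - (l : L) *: y)%R
   + sr_ext_weight y = #|finvect_type L|.-1 * sr_ext_weight x)%N.
Proof.
move=> he yx; rewrite exchange_big -big_split big_distrr /=.
apply: eq_bigr => i _.
rewrite -(sum_ext_weight (fun a => pairing_eq0_colsp he (yx i))).
congr (_ + _)%N; apply: eq_bigr => l _; rewrite submxrowB; congr ext_weight.
by congr (_ - _); apply/matrixP=> r s; rewrite !mxE.
Qed.

End SumRankWeight.

Theorem theorem4p3 (F : finFieldType) (L : fieldExtType F) (q m t k : nat)
    (hq : #|F| = q) (hm : \dim {:L} = m)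
    (e : m.-tuple L) (he : basis_of {:L} e)
    (m_gt0 : (0 < m)%N) (t_gt0 : (0 < t)%N) (k_gt0 : (0 < k)%N)
    (n : 'I_t -> nat) (n_gt0 : forall i, (0 < n i)%N)
    (C : {vspace 'rV[L]_(\sum_i n i)}) (hk : \dim C = k)
    (C_nondegenerate : nondegenerate_code C)
    (delta_max delta_min : rat)
    (h_max : is_max (code_rank_list C) (delta_value q n) delta_max)
    (h_min : is_min (code_rank_list C) (delta_value q n) delta_min)
    (h_AB : delta_max / delta_min < q%:R ^+ m / (q%:R ^+ m - 1)) :
  minimal_code e C.
Proof.
subst q; pose Q := (#|F| ^ m)%N.
(* [finvect_type L] is [L] viewed as a finite type, so that sums over scalars make sense. *)
have cardL : #|finvect_type L| = Q.
  by rewrite -(card_vspacef (Vector.on (finvect_type L))) card_vspace /Q -hm.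
have q_gt0 : (0 : rat) < #|F|%:R - 1.
  by rewrite subr_gt0 ltr1n finNzRing_gt1.
have Q_gt1 : (1 < Q)%N.
  by rewrite -(exp1n m) ltn_exp2r // finNzRing_gt1.
case: h_max h_AB => [[_ [cM [CM nM <-] <-]] leM].
case: h_min => [[_ [cm [Cm nm <-] <-]] lem] h_AB.
rewrite !delta_value_rank_list in leM lem h_AB.
set WM := sr_ext_weight cM in leM h_AB; set Wm := sr_ext_weight cm in lem h_AB.
have wle x : x \in C -> (sr_ext_weight x <= WM)%N.
  have [-> _|nx Cx] := eqVneq x 0; first by rewrite sr_ext_weight0.
  have /leM : code_rank_list C (rank_list x) by exists x.
  by rewrite delta_value_rank_list ler_pM2r ?invr_gt0 // ler_nat.
have wge x : x \in C -> x != 0 -> (Wm <= sr_ext_weight x)%N.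
  move=> Cx nx; have /lem : code_rank_list C (rank_list x) by exists x.
  by rewrite delta_value_rank_list ler_pM2r ?invr_gt0 // ler_nat.
(* The factor [#|F| - 1] cancels in the ratio; [Wm] and [Q - 1] are positive, so denominators
   clear. *)
have {h_AB} AB : (Q.-1 * WM < Q * Wm)%N.
  have Wm_gt0 : (0 < Wm)%N by apply: sr_ext_weight_gt0.
  move: h_AB; rewrite invf_div mulrA mulfVK ?gt_eqF // -natrX -/Q.
  rewrite -[Q%:R - 1](natrB _ (ltnW Q_gt1)) subn1 ltr_pdivrMr ?ltr0n //.
  rewrite mulrAC ltr_pdivlMr ?ltr0n -?subn1 ?subn_gt0 //.
  by rewrite -!natrM ltr_nat mulnC.
move=> c Cc c' Cc' supp.
have [->|nc'] := eqVneq c' 0; first by exists 0; rewrite scale0r.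
have [/existsP[l /eqP ->]|/existsPn indep] :=
  boolP [exists l : finvect_type L, c' == (l : L) *: c]; first by exists l.
have := sum_sr_ext_weight he supp; rewrite cardL => sumE.
suff : (Q * Wm <= Q.-1 * WM)%N by rewrite leqNgt AB.
apply: leq_trans (_ : Q.-1 * sr_ext_weight c <= _)%N; last first.
  by rewrite leq_mul2l wle ?orbT.
(* Of the [Q] copies of [Wm], one is charged to [c'] and one to each [c - l *: c'] with [l]
   nonzero. *)
rewrite -sumE -[X in (X * _ <= _)%N](prednK (ltnW Q_gt1)) mulSn addnC.
rewrite leq_add ?wge //.
rewrite -cardL -(cardC1 (0 : finvect_type L)) -sum_nat_const leq_sum // => l nl.
apply: wge; first by rewrite memvB ?memvZ.
(* If [c = l *: c'], then [c'] would be the excluded multiple [l^-1 *: c]. *)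
apply: contra (indep (l^-1 : L)) => /eqP/subr0_eq ->.
by rewrite scalerA mulVf ?scale1r.
Qed.
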